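(* Let $q=3^n$ and let $L/\mathbb{F}_q(x)$ be a separable cubic extension. Let $z$ be a generator of $L/\mathbb{F}_q(x)$ with minimal polynomial $X^3+bX+b^2$, where $b\in\mathbb{F}_q(x)$ is such that for every finite place $\mathfrak{q}$ of $\mathbb{F}_q(x)$, either $v_\mathfrak{q}(b)\ge 0$, or $v_\mathfrak{q}(b)<0$ and $(v_\mathfrak{q}(b),3)=1$. Write $$b=\frac{\xi_1\xi_2^2}{\beta},\qquad \beta=\prod_{i=1}^s p_i^{\ell_{\mathfrak{p}_i}},$$ where $\xi_1,\xi_2\in\mathbb{F}_q[x]$, $\xi_1$ is square-free, $(\xi_1\xi_2,\beta)=1$, the $p_i\in\mathbb{F}_q[x]$ are distinct irreducible polynomials, $p_i$ corresponding to the finite place $\mathfrak{p}_i$ of $\mathbb{F}_q(x)$, and $\ell_{\mathfrak{p}_i}>0$, $(\ell_{\mathfrak{p}_i},3)=1$ for each $i=1,\dots,s$. For $j=1,2$ let $$P_j=\prod_{i=1}^s p_i^{1+\left\lfloor \frac{2j\ell_{\mathfrak{p}_i}}{3}\right\rfloor}.$$ Then the set $$\mathfrak{B}=\left\{\frac{P_2}{\xi_1\xi_2^2}z^2,\ \frac{P_1}{\xi_2}z,\ 1\right\}$$ is an integral basis for $L/\mathbb{F}_q(x)$, i.e. an $\mathbb{F}_q[x]$-module basis of the integral closure $\mathcal{O}_{L,x}$ of $\mathbb{F}_q[x]$ in $L$.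
   Context: Finite places of $\mathbb{F}_q(x)$ are those corresponding to monic irreducible polynomials of $\mathbb{F}_q[x]$; $v_\mathfrak{q}$ is the normalized valuation at $\mathfrak{q}$; $(m,3)$ denotes the greatest common divisor; $\lfloor\cdot\rfloor$ is the integral part. *)

(* Defs.v *)
From HB Require Import structures.
From mathcomp Require Import all_boot all_order all_algebra all_field.

Set Implicit Arguments.
Unset Strict Implicit.
Unset Printing Implicit Defensive.

Import GRing.Theory.
Local Open Scope ring_scope.
Local Open Scope quotient_scope.

Section Places.
Variable F : fieldType.
Implicit Types (p f : {poly F}) (y : {fraction {poly F}}).

Definition finite_place p : Prop := p \is monic /\ irreducible_poly p.

(* For f != 0 and p nonconstant, p ^+ k %| f forces k < size f, so the bound
   on k loses nothing; multp p 0 = 0 is a junk value. *)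
Definition multp p f : nat := (\max_(k < size f | (p ^+ k %| f)%R) k)%N.

(* The normalized valuation at the place of p. It does not depend on the
   representative chosen by repr as long as y != 0; the value at y = 0, where
   the valuation is infinite, is junk. *)
Definition place_val p y : int :=
  (multp p \n_(repr y))%:Z - (multp p \d_(repr y))%:Z.

Definition squarefree_poly f : Prop :=
  forall d : {poly F}, d ^+ 2 %| f -> d %= 1.

End Places.

Section IntegralBasis.
Variables (F : fieldType) (L : fieldExtType {fraction {poly F}}).

Definition poly_emb (f : {poly F}) : L := in_alg L (tofrac f).

Definition in_integral_closure (y : L) : Prop := integralOver poly_emb y.

Definition integral_basis (m : nat) (e : m.-tuple L) : Prop :=
  (forall y : L, in_integral_closure y <->
     exists c : 'I_m -> {poly F}, y = \sum_(i < m) poly_emb (c i) * tnth e i) /\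
  (forall c : 'I_m -> {poly F},
     \sum_(i < m) poly_emb (c i) * tnth e i = 0 -> forall i, c i = 0).

End IntegralBasis.

Definition basis_factor (F : fieldType) (s : nat) (p : 'I_s -> {poly F})
    (l : 'I_s -> nat) (j : nat) : {poly F} :=
  \prod_(i < s) p i ^+ (1 + (2 * j * l i) %/ 3)%N.

(* Main.v *)
(* With u = P_1 z / xi_2 and w = P_2 z^2 / (xi_1 xi_2^2), the F[x]-module O
   spanned by 1, u, w is a ring: u^2 = A xi_1 w, u w = - D u - A B xi_1 xi_2 and
   w^2 = - D w - B xi_2 u, where A (resp. B) is the product of the p_i with l_i
   congruent to 2 (resp. 1) mod 3 and D = P_2 / beta. To see that O is
   integrally closed, use its norm form N, which is multiplicative. If y is
   integral then e y^k is in O for some e != 0 and all k, so e^3 N(y)^k is a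
   polynomial for all k, and N(y) is a polynomial because F[x] is completely
   integrally closed. In characteristic 3, N(y+1) + N(y-1) - 2 N(y) is, up to
   sign, the trace of y. Now let q be irreducible with q y in O. If q divides D,
   then q divides A B exactly once, and q^3 | N(q y) forces q to divide the
   coordinates of q y, one after the other. If q does not divide D, the traces
   of y, y w and y^2 give the same conclusion, since xi_1 is square-free. *)
Require Import Defs.
From HB Require Import structures.
From mathcomp Require Import all_boot all_order all_algebra all_field.
From mathcomp Require Import ring zify.

Set Implicit Arguments.
Unset Strict Implicit.
Unset Printing Implicit Defensive.

Import GRing.Theory.
Local Open Scope ring_scope.

(** * Norm form of a cubic ring *)

Section CubicRing.
Variable R : comNzRingType.
Variables A B D a c : R.
Implicit Types x y : R * R * R.

(* Triples are coordinates on a basis 1, u, w with u^2 = A a w,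
   u w = - D u - A B a c and w^2 = - D w - B c u. *)
Definition cubic_mul x y : R * R * R :=
  let: (x0, x1, x2) := x in let: (y0, y1, y2) := y in
  (x0 * y0 - A * B * a * c * (x1 * y2 + x2 * y1),
   x0 * y1 + x1 * y0 - D * (x1 * y2 + x2 * y1) - B * c * (x2 * y2),
   x0 * y2 + x2 * y0 + A * a * (x1 * y1) - D * (x2 * y2)).

(** Determinant of multiplication by [x] on the basis [1, u, w]. *)
Definition cubic_norm x : R :=
  let: (x0, x1, x2) := x in
  x0 ^+ 3 - D * x0 ^+ 2 * x2 *+ 2 + D ^+ 2 * x0 * x2 ^+ 2
  + A * a * D * x0 * x1 ^+ 2 + A * B * a * c * x0 * x1 * x2 *+ 3
  - A ^+ 2 * B * a ^+ 2 * c * x1 ^+ 3 - A * B * a * c * D * x1 * x2 ^+ 2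
  + A * B ^+ 2 * a * c ^+ 2 * x2 ^+ 3.

Lemma cubic_normM x y : cubic_norm (cubic_mul x y) = cubic_norm x * cubic_norm y.
Proof. case: x y => [[x0 x1] x2] [[y0 y1] y2] /=; ring. Qed.

(* In characteristic 3 the right-hand side is - D x2, minus the trace. *)
Lemma cubic_norm_trace (x0 x1 x2 : R) :
  cubic_norm (x0 + 1, x1, x2) + cubic_norm (x0 - 1, x1, x2)
  - cubic_norm (x0, x1, x2) *+ 2 = x0 *+ 6 - D * x2 *+ 4.
Proof. rewrite /=; ring. Qed.

End CubicRing.

(** * Irreducible divisors, and norms divisible by the cube of one *)

Section PolyDivisibility.
Variable F : fieldType.
Implicit Types f g q : {poly F}.

Lemma irredp_dvdM q f g :
  irreducible_poly q -> (q %| f * g) = (q %| f) || (q %| g).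
Proof.
move=> q_irr; case: (boolP (q %| f)) => [qf|]; first by rewrite dvdp_mulr.
by rewrite -irreducible_poly_coprime // => /Gauss_dvdpr->.
Qed.

Lemma irredp_dvdX q f n : irreducible_poly q -> q %| f ^+ n -> q %| f.
Proof.
move=> q_irr; elim: n => [|n IHn].
  by rewrite expr0 dvdp1 => /eqP sz1; case: q_irr; rewrite sz1.
by rewrite exprS irredp_dvdM // => /orP[].
Qed.

(** Lets [ring] derive [f = g] from a known equation [P = Q], up to cancelling a nonzero factor
    [k]. *)
Lemma subr_scaled_eq (k f g P Q : {poly F}) :
  k != 0 -> P = Q -> k * (f - g) = P - Q -> f = g.
Proof.
move=> k0 -> /eqP; rewrite subrr mulf_eq0 (negPf k0) subr_eq0.
by move=> /eqP.
Qed.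

Section Ramified.
Variables (q A B D a c : {poly F}).
Hypotheses (q_irr : irreducible_poly q) (qA : ~~ (q %| A)) (qB : ~~ (q %| B))
  (qa : ~~ (q %| a)) (qc : ~~ (q %| c)).

(** The coefficients of [x0 ^+ 3], [x2 ^+ 3] and [x1 ^+ 3] contain [q] exactly 0, 1 and 2 times.
    Reading the norm modulo [q], [q ^+ 2] and [q ^+ 3] isolates these cubes one after the other. *)
Lemma cubic_norm_dvd_A x0 x1 x2 :
    q ^+ 3 %| cubic_norm (q * A) B (q * D) a c (x0, x1, x2) ->
  [/\ q %| x0, q %| x1 & q %| x2].
Proof.
move=> /dvdpP[m /= Em].
have q0 : q != 0 := irredp_neq0 q_irr.
have /dvdpP[y0 Ey0] : q %| x0.
  apply: (@irredp_dvdX _ _ 3) => //.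
  rewrite (_ : x0 ^+ 3 = q * (m * q ^+ 2 + D * x0 ^+ 2 * x2 *+ 2
    - q * D ^+ 2 * x0 * x2 ^+ 2 - q * A * a * D * x0 * x1 ^+ 2
    - A * B * a * c * x0 * x1 * x2 *+ 3 + q * A ^+ 2 * B * a ^+ 2 * c * x1 ^+ 3
    + q * A * B * a * c * D * x1 * x2 ^+ 2
    - A * B ^+ 2 * a * c ^+ 2 * x2 ^+ 3)) ?dvdp_mulr //.
  by apply: (subr_scaled_eq (oner_neq0 _) Em); ring.
have /dvdpP[y2 Ey2] : q %| x2.
  have : q %| A * B ^+ 2 * a * c ^+ 2 * x2 ^+ 3.
    rewrite (_ : _ * _ = q * (m * q - q * y0 ^+ 3 + q * D * y0 ^+ 2 * x2 *+ 2
      - q * D ^+ 2 * y0 * x2 ^+ 2 - q * A * a * D * y0 * x1 ^+ 2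
      - A * B * a * c * y0 * x1 * x2 *+ 3 + A ^+ 2 * B * a ^+ 2 * c * x1 ^+ 3
      + A * B * a * c * D * x1 * x2 ^+ 2)) ?dvdp_mulr //.
    by apply: (subr_scaled_eq q0 Em); rewrite Ey0; ring.
  by rewrite !irredp_dvdM // (negPf qA) (negPf qB) (negPf qa) (negPf qc) /=;
    rewrite orbb => /orP[]// /orP[].
have -> : q %| x1; last by rewrite Ey0 Ey2 !dvdp_mull.
have : q %| A ^+ 2 * B * a ^+ 2 * c * x1 ^+ 3.
  rewrite (_ : _ * _ = q * (y0 ^+ 3 - q * D * y0 ^+ 2 * y2 *+ 2
    + q ^+ 2 * D ^+ 2 * y0 * y2 ^+ 2 + A * a * D * y0 * x1 ^+ 2
    + A * B * a * c * y0 * x1 * y2 *+ 3 - q * A * B * a * c * D * x1 * y2 ^+ 2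
    + q * A * B ^+ 2 * a * c ^+ 2 * y2 ^+ 3 - m)) ?dvdp_mulr //.
  apply: (@subr_scaled_eq (- q ^+ 2) _ _ _ _ _ Em).
    by rewrite oppr_eq0 expf_neq0.
  by rewrite Ey0 Ey2; ring.
by rewrite !irredp_dvdM // (negPf qA) (negPf qB) (negPf qa) (negPf qc) /=;
  rewrite orbb => /orP[]// /orP[].
Qed.

(** Here the coefficient of [x1 ^+ 3] contains [q] once and that of [x2 ^+ 3] twice, so the cubes
    are isolated in the order [x0], [x1], [x2]. *)
Lemma cubic_norm_dvd_B x0 x1 x2 :
    q ^+ 3 %| cubic_norm A (q * B) (q * D) a c (x0, x1, x2) ->
  [/\ q %| x0, q %| x1 & q %| x2].
Proof.
move=> /dvdpP[m /= Em].
have q0 : q != 0 := irredp_neq0 q_irr.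
have /dvdpP[y0 Ey0] : q %| x0.
  apply: (@irredp_dvdX _ _ 3) => //.
  rewrite (_ : x0 ^+ 3 = q * (m * q ^+ 2 + D * x0 ^+ 2 * x2 *+ 2
    - q * D ^+ 2 * x0 * x2 ^+ 2 - A * a * D * x0 * x1 ^+ 2
    - A * B * a * c * x0 * x1 * x2 *+ 3 + A ^+ 2 * B * a ^+ 2 * c * x1 ^+ 3
    + q * A * B * a * c * D * x1 * x2 ^+ 2
    - q * A * B ^+ 2 * a * c ^+ 2 * x2 ^+ 3)) ?dvdp_mulr //.
  by apply: (subr_scaled_eq (oner_neq0 _) Em); ring.
have /dvdpP[y1 Ey1] : q %| x1.
  have : q %| A ^+ 2 * B * a ^+ 2 * c * x1 ^+ 3.
    rewrite (_ : _ * _ = q * (q * y0 ^+ 3 - q * D * y0 ^+ 2 * x2 *+ 2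
      + q * D ^+ 2 * y0 * x2 ^+ 2 + A * a * D * y0 * x1 ^+ 2
      + A * B * a * c * y0 * x1 * x2 *+ 3 - A * B * a * c * D * x1 * x2 ^+ 2
      + A * B ^+ 2 * a * c ^+ 2 * x2 ^+ 3 - m * q)) ?dvdp_mulr //.
    apply: (@subr_scaled_eq (- q) _ _ _ _ _ Em); first by rewrite oppr_eq0.
    by rewrite Ey0; ring.
  by rewrite !irredp_dvdM // (negPf qA) (negPf qB) (negPf qa) (negPf qc) /=;
    rewrite orbb => /orP[]// /orP[].
have -> : q %| x2; last by rewrite Ey0 Ey1 !dvdp_mull.
have : q %| A * B ^+ 2 * a * c ^+ 2 * x2 ^+ 3.
  rewrite (_ : _ * _ = q * (m - y0 ^+ 3 + D * y0 ^+ 2 * x2 *+ 2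
    - D ^+ 2 * y0 * x2 ^+ 2 - q * A * a * D * y0 * y1 ^+ 2
    - A * B * a * c * y0 * y1 * x2 *+ 3 + q * A ^+ 2 * B * a ^+ 2 * c * y1 ^+ 3
    + A * B * a * c * D * y1 * x2 ^+ 2)) ?dvdp_mulr //.
  apply: (@subr_scaled_eq (q ^+ 2) _ _ _ _ _ Em); first by rewrite expf_neq0.
  by rewrite Ey0 Ey1; ring.
by rewrite !irredp_dvdM // (negPf qA) (negPf qB) (negPf qa) (negPf qc) /=;
  rewrite orbb => /orP[]// /orP[].
Qed.

End Ramified.

End PolyDivisibility.

(** * Fractions of polynomials *)

Section Fractions.

Lemma fraction_clear (R : idomainType) (x : {fraction R}) :
  exists n d, d != 0 /\ x * tofrac d = tofrac n.
Proof.
elim/quotW: x => r; exists \n_r, \d_r; split; first exact: denom_ratioP.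
apply/eqP; rewrite piE /FracField.equivf /FracField.mulf.
by rewrite !numden_Ratio ?mulf_neq0 ?oner_neq0 ?denom_ratioP // !mulr1 mulrC.
Qed.

Variable F : fieldType.

Lemma fraction_coprime (x : {fraction {poly F}}) :
  exists n d, [/\ d != 0, coprimep d n & x * tofrac d = tofrac n].
Proof.
have [n [d [d0 xd]]] := fraction_clear x.
have g0 : gcdp d n != 0 by rewrite gcdp_eq0 (negPf d0).
exists (n %/ gcdp d n), (d %/ gcdp d n); split.
- by rewrite dvdp_div_eq0 ?dvdp_gcdl.
- by rewrite coprimep_div_gcd ?d0.
- apply: (@mulIf _ (tofrac (gcdp d n))); first by rewrite tofrac_eq0.
  by rewrite -mulrA -!rmorphM /= !divpK ?dvdp_gcdl ?dvdp_gcdr.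
Qed.

(** If [x = n / d] in lowest terms, every power of [d] divides the fixed polynomial [e], so [d] is
    constant. *)
Lemma completely_integrally_closed (x : {fraction {poly F}}) (e : {poly F}) :
    e != 0 -> (forall k, exists f, tofrac e * x ^+ k = tofrac f) ->
  exists f, x = tofrac f.
Proof.
move=> e0 xk; have [n [d [d0 dn xd]]] := fraction_coprime x.
have dvd_e k : d ^+ k %| e.
  have [f Ef] := xk k; rewrite -(@Gauss_dvdpl _ _ (n ^+ k)).
    apply/dvdpP; exists f; apply/eqP; rewrite -tofrac_eq !rmorphM !rmorphXn /=.
    by rewrite -xd exprMn mulrA Ef.
  exact/coprimep_expl/coprimep_expr.
have : size d == 1%N.
  (* For nonconstant [d], the power [d ^+ size e] has degree at least [size e], too large for a
     divisor of [e]. *)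
  have := dvdp_leq e0 (dvd_e (size e)); have := size_exp d (size e).
  move: d0 e0; rewrite -!size_poly_gt0.
  move: (size (d ^+ size e)) => s1; move: (size d) (size e) => s2 s3; nia.
case/size_poly1P=> r r0 Ed; exists (r^-1 *: n).
apply: (@mulIf _ (tofrac d)); first by rewrite tofrac_eq0.
by rewrite xd -rmorphM /= Ed -scalerAl mulrC mul_polyC scalerA mulVf ?scale1r.
Qed.

Lemma irredp_sqr_ndvd (q f : {poly F}) :
  irreducible_poly q -> squarefree_poly f -> ~~ (q ^+ 2 %| f).
Proof.
move=> q_irr f_sqf; apply/negP => /f_sqf/eqp_size; rewrite size_poly1 => q1.
by case: q_irr; rewrite q1.
Qed.

Lemma dvdp_tofrac (q d f : {poly F}) (x : {fraction {poly F}}) :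
  tofrac q * x = tofrac d -> x = tofrac f -> q %| d.
Proof.
move=> qx xf; apply/dvdpP; exists f; apply/eqP; rewrite -tofrac_eq -qx xf.
by rewrite -rmorphM mulrC.
Qed.

End Fractions.

(** Over a finite field irreducibility is a finite test; its failure yields a nonconstant divisor of
    smaller size, and induction applies. *)
Lemma irredp_factor (F : finFieldType) (f : {poly F}) :
  (1 < size f)%N -> exists2 q, irreducible_poly q & q %| f.
Proof.
have [n] := ubnP (size f); elim: n f => // n IHn f f_n f_gt1.
have [/irreducibleP fi | ] := boolP (irreducibleb f); first by exists f.
rewrite /irreducibleb f_gt1 => /forallPn[g]; rewrite negb_imply -ltnNge.
case/andP=> gf g_gt1.
have {}gf : g %| f by rewrite Pdiv.Idomain.dvdpE.
have g_lt : (size g < size f)%N.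
  by rewrite (leq_ltn_trans (size_npoly g)) // ltn_predL ltnW.
have [|q q_irr qg] := IHn g _ g_gt1; first exact: leq_trans g_lt f_n.
by exists q => //; apply: dvdp_trans gf.
Qed.

(** * Integral closedness of the cubic order *)

Lemma cubic_mul_comb (R S : comNzRingType) (h : {rmorphism R -> S})
    (A B D a c : R) (u w : S) (x y : R * R * R) :
    u ^+ 2 = h (A * a) * w ->
    u * w = - (h D * u + h (A * B * a * c)) ->
    w ^+ 2 = - (h D * w + h (B * c) * u) ->
  let comb z := h z.1.1 + h z.1.2 * u + h z.2 * w in
  comb (cubic_mul A B D a c x y) = comb x * comb y.
Proof.
case: x y => [[x0 x1] x2] [[y0 y1] y2] uu uw ww /=.
transitivity (h x0 * h y0 + (h x0 * h y1 + h x1 * h y0) * u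
   + (h x0 * h y2 + h x2 * h y0) * w + h x1 * h y1 * u ^+ 2
   + (h x1 * h y2 + h x2 * h y1) * (u * w) + h x2 * h y2 * w ^+ 2); last by ring.
by rewrite uu uw ww !(rmorphM, rmorphB, rmorphD); ring.
Qed.

Section CubicOrder.
Variables (F : finFieldType) (L : fieldType).
Variables (iota : {rmorphism {fraction {poly F}} -> L}).
Variables (emb : {rmorphism {poly F} -> L}).
Hypothesis embE : forall f, emb f = iota (tofrac f).
Variables (A B D a c : {poly F}) (u w : L).
Local Notation K := {fraction {poly F}}.

Hypotheses (uu : u ^+ 2 = emb (A * a) * w)
  (uw : u * w = - (emb D * u + emb (A * B * a * c)))
  (ww : w ^+ 2 = - (emb D * w + emb (B * c) * u)).

Definition cubic_elt (x : K * K * K) : L :=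
  iota x.1.1 + iota x.1.2 * u + iota x.2 * w.

(** Expresses that [1, u, w] is a basis of [L] over the fraction field. *)
Hypothesis cubic_elt_bij : bijective cubic_elt.

Local Notation mulK :=
  (cubic_mul (tofrac A) (tofrac B) (tofrac D) (tofrac a) (tofrac c)).
Local Notation normK :=
  (cubic_norm (tofrac A) (tofrac B) (tofrac D) (tofrac a) (tofrac c)).

Lemma cubic_eltM x y : cubic_elt (mulK x y) = cubic_elt x * cubic_elt y.
Proof.
have uuK : u ^+ 2 = iota (tofrac A * tofrac a) * w.
  by rewrite uu embE tofracM.
have uwK : u * w = - (iota (tofrac D) * u
    + iota (tofrac A * tofrac B * tofrac a * tofrac c)).
  by rewrite uw !embE !tofracM.
have wwK : w ^+ 2 = - (iota (tofrac D) * w + iota (tofrac B * tofrac c) * u).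
  by rewrite ww !embE tofracM.
exact: (cubic_mul_comb x y uuK uwK wwK).
Qed.

Definition cubic_polys (d : {poly F} * {poly F} * {poly F}) : K * K * K :=
  (tofrac d.1.1, tofrac d.1.2, tofrac d.2).

Definition in_cubic_order (y : L) := exists d, y = cubic_elt (cubic_polys d).

Lemma in_cubic_orderD y z :
  in_cubic_order y -> in_cubic_order z -> in_cubic_order (y + z).
Proof.
move=> [d ->] [e ->]; exists (d.1.1 + e.1.1, d.1.2 + e.1.2, d.2 + e.2).
by rewrite /cubic_elt /= !rmorphD /=; ring.
Qed.

Lemma in_cubic_order_emb f : in_cubic_order (emb f).
Proof.
by exists (f, 0, 0); rewrite /cubic_elt /= !rmorph0 !mul0r !addr0.
Qed.

Lemma in_cubic_orderM y z :
  in_cubic_order y -> in_cubic_order z -> in_cubic_order (y * z).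
Proof.
move=> [d ->] [e ->]; exists (cubic_mul A B D a c d e); rewrite -cubic_eltM.
case: d e => [[d0 d1] d2] [[e0 e1] e2]; congr cubic_elt.
by rewrite /cubic_polys /= !(rmorphB, rmorphD, rmorphM).
Qed.

Lemma in_cubic_orderX y n : in_cubic_order y -> in_cubic_order (y ^+ n).
Proof.
move=> Oy; elim: n => [|n IHn]; last by rewrite exprS; apply: in_cubic_orderM.
by rewrite expr0 -(rmorph1 emb); apply: in_cubic_order_emb.
Qed.

Lemma in_cubic_order_sum n (G : 'I_n -> L) :
  (forall i, in_cubic_order (G i)) -> in_cubic_order (\sum_i G i).
Proof.
move=> OG; elim/big_ind: _ => //; last exact: in_cubic_orderD.
by rewrite -(rmorph0 emb); apply: in_cubic_order_emb.
Qed.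

Lemma cubic_order_denominator y :
  exists2 e, e != 0 & in_cubic_order (emb e * y).
Proof.
have [g _ gK] := cubic_elt_bij; rewrite -(gK y).
case: (g y) => [[x0 x1] x2].
have [n0 [e0 [e0_neq0 E0]]] := fraction_clear x0.
have [n1 [e1 [e1_neq0 E1]]] := fraction_clear x1.
have [n2 [e2 [e2_neq0 E2]]] := fraction_clear x2.
exists (e0 * e1 * e2); first by rewrite !mulf_neq0.
exists (n0 * e1 * e2, e0 * n1 * e2, e0 * e1 * n2).
rewrite /cubic_elt /= ?embE !rmorphM /= -E0 -E1 -E2 !rmorphM /=; ring.
Qed.

(** If [y] is a root of a monic polynomial of degree [n] and [e * y] lies in the order, then
    [e ^+ n] serves for all powers: directly for [k <= n], and by reduction with the monic equation
    beyond. *)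
Lemma integral_powers_denominator y : integralOver emb y ->
  exists2 e, e != 0 & forall k, in_cubic_order (emb e * y ^+ k).
Proof.
case=> p p_monic /rootP py0; have [e e0 Oe] := cubic_order_denominator y.
have [n sz_p] : exists n, size p = n.+1.
  by exists (size p).-1; rewrite prednK // size_poly_gt0 monic_neq0.
have yn : y ^+ n = - (\sum_(i < n) emb p`_i * y ^+ i).
  apply/eqP; rewrite -addr_eq0 addrC -[X in _ == X]py0 horner_coef.
  rewrite size_map_poly_id0; last by rewrite (monicP p_monic) rmorph1 oner_neq0.
  rewrite sz_p big_ord_recr /= coef_map /=.
  have -> : p`_n = 1 by rewrite -(monicP p_monic) lead_coefE sz_p.
  rewrite rmorph1 mul1r; apply/eqP; congr (_ + _).
  by apply: eq_bigr => i _; rewrite coef_map.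
exists (e ^+ n) => [|k]; first by rewrite expf_neq0.
elim/ltn_ind: k => k IHk; case: (leqP k n) => [k_n | n_k].
  rewrite -(subnK k_n) exprD rmorphM !rmorphXn /= -mulrA -exprMn.
  apply: in_cubic_orderM; last exact: in_cubic_orderX.
  by rewrite -rmorphXn; apply: in_cubic_order_emb.
rewrite -(subnK (ltnW n_k)) exprD yn mulrN mulrN -mulN1r -(rmorphN1 emb).
apply: in_cubic_orderM; first exact: in_cubic_order_emb.
rewrite mulrA mulr_sumr; apply: in_cubic_order_sum => i.
rewrite mulrCA -mulrA -exprD; apply: in_cubic_orderM.
  exact: in_cubic_order_emb.
by apply: IHk; have := ltn_ord i; lia.
Qed.

(** * Norms and traces of integral elements *)

Lemma cubic_norm_scale s x0 x1 x2 :
  normK (s * x0, s * x1, s * x2) = s ^+ 3 * normK (x0, x1, x2).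
Proof. by rewrite /=; ring. Qed.

Lemma cubic_norm_polys d :
  normK (cubic_polys d) = tofrac (cubic_norm A B D a c d).
Proof.
case: d => [[d0 d1] d2]; rewrite /cubic_polys /=.
by rewrite !(rmorphB, rmorphD, rmorphMn, rmorphM, rmorphXn).
Qed.

Lemma cubic_eltX x k :
  exists2 z, cubic_elt z = cubic_elt x ^+ k & normK z = normK x ^+ k.
Proof.
elim: k => [|k [z Ez Nz]].
  exists (1, 0, 0); last by rewrite expr0 /=; ring.
  by rewrite /cubic_elt /= !rmorph0 rmorph1 !mul0r !addr0 expr0.
exists (mulK x z); first by rewrite cubic_eltM Ez exprS.
by rewrite cubic_normM Nz exprS.
Qed.

(** The norm is homogeneous of degree 3, so a denominator [e] for all powers of the element gives
    the denominator [e ^+ 3] for all powers of its norm. *)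
Lemma integral_cubic_norm x :
  integralOver emb (cubic_elt x) -> exists f, normK x = tofrac f.
Proof.
case/integral_powers_denominator=> e e0 Oe.
apply: (@completely_integrally_closed _ _ (e ^+ 3)); first by rewrite expf_neq0.
move=> k; have [d Ed] := Oe k; have [z Ez Nz] := cubic_eltX x k.
exists (cubic_norm A B D a c d); rewrite -cubic_norm_polys -Nz.
have [g eltK _] := cubic_elt_bij.
have <- : (tofrac e * z.1.1, tofrac e * z.1.2, tofrac e * z.2) = cubic_polys d.
  apply: (can_inj eltK); rewrite -Ed -Ez /cubic_elt ?embE /= !rmorphM /=; ring.
by case: (z) => [[z0 z1] z2]; rewrite cubic_norm_scale rmorphXn.
Qed.

Hypothesis F_char3 : 3%:R = 0 :> F.

(** The element and its translates by 1 and -1 are integral, so their norms are polynomials. The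
    second difference of these norms is [6 x0 - 4 D x2], that is [- D x2] in characteristic 3. *)
Lemma integral_cubic_trace x :
  integralOver emb (cubic_elt x) -> exists f, tofrac D * x.2 = tofrac f.
Proof.
case: x => [[x0 x1] x2] Ix.
have shift s : cubic_elt (x0 + s, x1, x2) = cubic_elt (x0, x1, x2) + iota s.
  by rewrite /cubic_elt /= rmorphD /=; ring.
have Ix1 : integralOver emb (cubic_elt (x0 + 1, x1, x2)).
  by rewrite shift rmorph1; apply: integral_add => //; apply: integral1.
have Ix2 : integralOver emb (cubic_elt (x0 - 1, x1, x2)).
  by rewrite shift rmorphN1; apply: integral_sub => //; apply: integral1.
have [f Ef] := integral_cubic_norm Ix.
have [f1 Ef1] := integral_cubic_norm Ix1.
have [f2 Ef2] := integral_cubic_norm Ix2.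
exists (- (f1 + f2 - f *+ 2)).
rewrite rmorphN rmorphB rmorphD rmorphMn /= -Ef -Ef1 -Ef2 cubic_norm_trace.
have K3 : 3%:R = 0 :> K.
  rewrite -(rmorph_nat (@FracField.tofrac {poly F})) -(rmorph_nat polyC).
  by rewrite F_char3 !rmorph0.
transitivity (tofrac D * x2 + 3%:R * (tofrac D * x2 - x0 *+ 2)); last by ring.
by rewrite K3 mul0r addr0.
Qed.

Lemma integral_monic_cubic y r0 r1 r2 :
  y ^+ 3 + emb r2 * y ^+ 2 + emb r1 * y + emb r0 = 0 -> integralOver emb y.
Proof.
move=> y0; exists (Poly [:: r0; r1; r2; 1]).
  by rewrite monicE lead_coefE (@PolyK _ 0) //= oner_neq0.
rewrite /= !cons_poly_def mul0r add0r; apply/rootP.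
rewrite !(rmorphD, rmorphM) /= !map_polyC map_polyX /= rmorph1 !hornerE -[RHS]y0.
by ring.
Qed.

Lemma integral_cubic_u : integralOver emb u.
Proof.
(* Coefficients of the characteristic polynomial of [u], the norm form at [(X, -1, 0)]. *)
apply: (@integral_monic_cubic _ (A ^+ 2 * B * a ^+ 2 * c) (A * a * D) 0).
have -> : u ^+ 3 = emb (A * a) * (u * w) by rewrite exprSr uu; ring.
by rewrite uw; ring.
Qed.

Lemma integral_cubic_w : integralOver emb w.
Proof.
(* Likewise the norm form at [(X, 0, -1)]. *)
apply: (@integral_monic_cubic _ (- (A * B ^+ 2 * a * c ^+ 2)) (D ^+ 2) (D *+ 2)).
have -> : w ^+ 3 = - (emb D * w ^+ 2 + emb (B * c) * (u * w)).
  by rewrite exprSr {1}ww; ring.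
rewrite uw.
(* Only one copy of [D * w ^+ 2] is reduced; the other cancels the one coming from [w ^+ 3]. *)
have -> : emb (D *+ 2) * w ^+ 2 = emb D * w ^+ 2 - emb D * (emb D * w + emb (B * c) * u).
  by rewrite -mulrN -ww; ring.
by ring.
Qed.

Lemma in_cubic_order_integral y : in_cubic_order y -> integralOver emb y.
Proof.
case=> [[[d0 d1] d2] ->]; rewrite /cubic_elt /= -!embE.
by apply: integral_add; first apply: integral_add;
  rewrite ?mulr1; do ?[apply: integral_mul];
  (exact: integral_id || exact: integral_cubic_u || exact: integral_cubic_w).
Qed.

(** An irreducible [q] dividing [D] divides exactly one of [A] and [B], exactly once, and neither
    [a] nor [c]; any other [q] divides neither [A] nor [B]. *)
Hypotheses (AB_sqf : squarefree_poly (A * B)) (a_sqf : squarefree_poly a)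
  (dvd_D : forall q, irreducible_poly q -> (q %| D) = (q %| A * B))
  (coprime_D : coprimep (a * c) D).

(** As [q] is prime to [D], the trace form [D * x.2] detects divisibility of the last coordinate.
    Applied to [y], [y * w] and [y ^+ 2] it yields [d2], [d0] and [d1]. *)
Lemma integral_cubic_unramified q x d :
    irreducible_poly q -> ~~ (q %| D) -> integralOver emb (cubic_elt x) ->
    tofrac q * x.1.1 = tofrac d.1.1 -> tofrac q * x.1.2 = tofrac d.1.2 ->
    tofrac q * x.2 = tofrac d.2 ->
  [/\ q %| d.1.1, q %| d.1.2 & q %| d.2].
Proof.
case: x d => [[x0 x1] x2] [[d0 d1] d2] q_irr qD Ix /= E0 E1 E2.
have q0 : q != 0 := irredp_neq0 q_irr.
have qA : ~~ (q %| A).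
  by apply: contra qD => qA; rewrite dvd_D // dvdp_mulr.
have dvdD f : (q %| D * f) = (q %| f) by rewrite irredp_dvdM // (negPf qD).
have q_d2 : q %| d2.
  rewrite -dvdD; have [f Ef] := integral_cubic_trace Ix.
  by apply: (dvdp_tofrac _ Ef); rewrite mulrCA E2 -rmorphM.
have q_d0 : q %| d0.
  have Iw : cubic_elt (0, 0, 1) = w.
    by rewrite /cubic_elt /= !rmorph0 rmorph1; ring.
  (* The last coordinate of [y * w] is [x0 - D * x2]. *)
  have [f] : exists f, tofrac D * (mulK (x0, x1, x2) (0, 0, 1)).2 = tofrac f.
    apply: integral_cubic_trace; rewrite cubic_eltM Iw.
    exact: integral_mul Ix integral_cubic_w.
  rewrite /= !mulr0 mulr1 addr0 addr0 mulr1 => Ef.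
  have : q %| D * (d0 - D * d2).
    apply: (dvdp_tofrac _ Ef).
    rewrite !(rmorphM, rmorphB) /= -E0 -E2; ring.
  by rewrite dvdD dvdp_subl // dvdp_mull.
split=> //; apply: contraT => q_d1.
have [f Ef] : exists f, tofrac D * (mulK (x0, x1, x2) (x0, x1, x2)).2 = tofrac f.
  by apply: integral_cubic_trace; rewrite cubic_eltM; apply: integral_mul.
have /dvdpP[e0 Ee0] := q_d0; have /dvdpP[e2 Ee2] := q_d2.
(* The trace of [y ^+ 2], scaled by [q ^+ 2]. Modulo [q ^+ 2] only [D * A * a * d1 ^+ 2] survives,
   so [q ^+ 2] would divide [a] if [q] did not divide [d1]. *)
have : q ^+ 2 %| D * (d0 * d2 *+ 2 + A * a * d1 ^+ 2 - D * d2 ^+ 2).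
  apply: (dvdp_tofrac _ Ef).
  by rewrite !(rmorphM, rmorphB, rmorphD, rmorphMn, rmorphXn) /= -E0 -E1 -E2; ring.
rewrite (_ : _ * (_ - _) = a * (D * A * d1 ^+ 2)
    + q ^+ 2 * (D * (e0 * e2 *+ 2 - D * e2 ^+ 2))); last first.
  by rewrite Ee0 Ee2; ring.
rewrite dvdp_addl; last exact: dvdp_mulr.
rewrite Gauss_dvdpl.
  by rewrite (negPf (irredp_sqr_ndvd q_irr a_sqf)).
apply: coprimep_expl; rewrite irreducible_poly_coprime // !irredp_dvdM //.
by rewrite (negPf qD) (negPf qA) /= orbb.
Qed.

(** Since the norm of [y] is a polynomial, [q ^+ 3] divides that of [q * y]. The two cases are
    whether [q] divides [A] or [B]. *)
Lemma integral_cubic_ramified q x d :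
    irreducible_poly q -> q %| D -> integralOver emb (cubic_elt x) ->
    tofrac q * x.1.1 = tofrac d.1.1 -> tofrac q * x.1.2 = tofrac d.1.2 ->
    tofrac q * x.2 = tofrac d.2 ->
  [/\ q %| d.1.1, q %| d.1.2 & q %| d.2].
Proof.
case: x d => [[x0 x1] x2] [[d0 d1] d2] q_irr qD Ix /= E0 E1 E2.
have q_norm : q ^+ 3 %| cubic_norm A B D a c (d0, d1, d2).
  have [f Ef] := integral_cubic_norm Ix.
  apply: (dvdp_tofrac _ Ef); rewrite -cubic_norm_polys /cubic_polys.
  by rewrite -E0 -E1 -E2 rmorphXn -cubic_norm_scale.
have : coprimep (a * c) q by rewrite (coprimep_dvdl qD).
rewrite coprimep_sym irreducible_poly_coprime // irredp_dvdM // negb_or.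
case/andP=> qa qc.
have q_AB := irredp_sqr_ndvd q_irr AB_sqf.
have /dvdpP[D' ED] := qD.
have := qD; rewrite dvd_D // irredp_dvdM //; case/orP=> /dvdpP[A' EA].
- have qB : ~~ (q %| B).
    by apply: contra q_AB => qB; rewrite expr2 EA dvdp_mul ?dvdp_mull.
  have qA : ~~ (q %| A').
    by apply: contra q_AB => qA'; rewrite dvdp_mulr // expr2 EA dvdp_mul.
  by move: q_norm; rewrite ED EA ![_ * q]mulrC; apply: cubic_norm_dvd_A.
- have qA : ~~ (q %| A).
    by apply: contra q_AB => qA; rewrite expr2 EA dvdp_mul ?dvdp_mull.
  have qB : ~~ (q %| A').
    by apply: contra q_AB => qA'; rewrite dvdp_mull // expr2 EA dvdp_mul.
  by move: q_norm; rewrite ED EA ![_ * q]mulrC; apply: cubic_norm_dvd_B.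
Qed.

(** Descent on the denominator [e = e' * q]: the element [e' * y] is integral and [q] times it lies
    in the order, so the local lemmas remove [q]. *)
Lemma integral_in_cubic_order y : integralOver emb y -> in_cubic_order y.
Proof.
move=> Iy; have [e e0] := cubic_order_denominator y.
have [n] := ubnP (size e); elim: n e e0 => // n IHn e e0 e_n [d Ed].
have [e1 | e_gt1] := leqP (size e) 1.
  have /size_poly1P[r r0 Ee] : size e == 1%N by rewrite eqn_leq e1 size_poly_gt0.
  rewrite (_ : y = emb r^-1%:P * (emb e * y)).
    by apply: in_cubic_orderM; [exact: in_cubic_order_emb | exists d].
  by rewrite mulrA -rmorphM Ee -polyCM mulVf // rmorph1 mul1r.
have [q q_irr /dvdpP[e' Ee]] := irredp_factor e_gt1.
have q0 : q != 0 := irredp_neq0 q_irr.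
have e'0 : e' != 0 by apply: contraNneq e0 => e'0; rewrite Ee e'0 mul0r.
have size_e' : (size e' < n)%N.
  move: e_n; rewrite Ee size_mul //; case: (q_irr) => q_gt1 _.
  rewrite ltnS; apply: leq_trans; case: (size q) q_gt1 => [|[|k]] // _.
  by rewrite !addnS ltnS leq_addr.
apply: (IHn e') => //.
have Ie'y : integralOver emb (emb e' * y).
  by apply: integral_mul => //; apply: integral_id.
have [g eltK gK] := cubic_elt_bij.
move: Ie'y; rewrite -(gK (emb e' * y)); set x := g _ => Ix.
have Eqx : (tofrac q * x.1.1, tofrac q * x.1.2, tofrac q * x.2) = cubic_polys d.
  apply: (can_inj eltK); rewrite -Ed; transitivity (emb q * cubic_elt x).
    by rewrite /cubic_elt /= !rmorphM embE; ring.
  by rewrite gK Ee; ring.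
case: Eqx => E0 E1 E2.
have [] : [/\ q %| d.1.1, q %| d.1.2 & q %| d.2].
  have [qD|qD] := boolP (q %| D); first exact: integral_cubic_ramified E0 E1 E2.
  exact: integral_cubic_unramified E0 E1 E2.
have tq0 : tofrac q != 0 by rewrite tofrac_eq0.
move=> /dvdpP[f0 Ef0] /dvdpP[f1 Ef1] /dvdpP[f2 Ef2]; exists (f0, f1, f2).
congr cubic_elt; rewrite /cubic_polys /= (surjective_pairing x) (surjective_pairing x.1).
by congr (_, _, _); apply: (mulfI tq0);
  rewrite ?E0 ?E1 ?E2 -rmorphM mulrC -?Ef0 -?Ef1 -?Ef2.
Qed.

End CubicOrder.

(** * The generator z *)

(** The cubic equation of [z] lowers [z ^+ 3] and [z ^+ 4]; the four relations on [P1] and [P2] then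
    absorb every power of [beta]. *)
Lemma cubic_order_relations (L : fieldType) (z a c beta P1 P2 A B D : L) :
    a != 0 -> c != 0 -> beta != 0 ->
    z ^+ 3 + a * c ^+ 2 / beta * z + (a * c ^+ 2 / beta) ^+ 2 = 0 ->
    P1 ^+ 2 = A * P2 -> P2 ^+ 2 = B * beta ^+ 2 * P1 -> P1 * P2 = A * B * beta ^+ 2 ->
    P2 = D * beta ->
  let u := P1 / c * z in let w := P2 / (a * c ^+ 2) * z ^+ 2 in
  [/\ u ^+ 2 = A * a * w, u * w = - (D * u + A * B * a * c)
    & w ^+ 2 = - (D * w + B * c * u)].
Proof.
move=> a0 c0 b0 z3 P11 P22 P12 P2D u w; rewrite {}/u {}/w.
have {}z3 : z ^+ 3 = - (a * c ^+ 2 / beta * z + (a * c ^+ 2 / beta) ^+ 2).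
  by apply/eqP; rewrite -addr_eq0 addrA z3.
split.
- transitivity (P1 ^+ 2 / c ^+ 2 * z ^+ 2); first by field.
  by rewrite P11; field; rewrite a0 c0.
- transitivity (P1 * P2 / (a * c ^+ 3) * z ^+ 3); first by field; rewrite a0 c0.
  rewrite z3.
  transitivity (- (P2 * P1 / (beta * c) * z + P1 * P2 * (a * c / beta ^+ 2))).
    by field; rewrite a0 b0 c0.
  by rewrite P12 P2D; field; rewrite b0 c0.
- transitivity (P2 ^+ 2 / (a ^+ 2 * c ^+ 4) * (z ^+ 3 * z)); first by field; rewrite a0 c0.
  rewrite z3.
  transitivity (- (P2 * P2 / (a * c ^+ 2 * beta) * z ^+ 2 + P2 ^+ 2 / beta ^+ 2 * z)).
    by field; rewrite a0 b0 c0.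
  (* Only one factor [P2] becomes [D * beta]; the other is needed to form [w]. *)
  by rewrite P22 {1}P2D; field; rewrite a0 b0 c0.
Qed.

Lemma inj_surj_bijective (T : choiceType) (S : eqType) (f : T -> S) :
  injective f -> (forall y, exists x, f x = y) -> bijective f.
Proof.
move=> f_inj f_surj.
have f_surjb y : exists x, f x == y by have [x <-] := f_surj y; exists x.
have gK : cancel (fun y => xchoose (f_surjb y)) f.
  by move=> y; apply/eqP; apply: (xchooseP (f_surjb y)).
by exists (fun y => xchoose (f_surjb y)) => // x; apply: f_inj; rewrite gK.
Qed.

(** * Products of pairwise non-associate irreducible polynomials *)

Section IrreducibleProducts.
Variables (F : finFieldType) (s : nat) (p : 'I_s -> {poly F}).
Hypotheses (p_irr : forall i, irreducible_poly (p i))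
  (p_distinct : forall i j, i != j -> ~~ (p i %= p j)).

Lemma irredp_dvd_prodX q (e : 'I_s -> nat) : (forall i, 0 < e i)%N ->
  irreducible_poly q -> (q %| \prod_i p i ^+ e i) = [exists i, q %| p i].
Proof.
move=> e_gt0 q_irr; apply/idP/existsP => [|[i q_pi]].
  elim/big_ind: _ => [|f g IHf IHg|i _ /irredp_dvdX q_pi].
  - by rewrite dvdp1 => /eqP q1; case: q_irr; rewrite q1.
  - by rewrite irredp_dvdM // => /orP[].
  - by exists i; apply: q_pi.
by rewrite (bigD1 i) //= dvdp_mulr // dvdp_exp.
Qed.

(** An irreducible [q] whose square divides the product is associate to some [p j]; after cancelling
    [p j] it is also associate to a [p i] with [i != j]. *)
Lemma squarefree_prod : squarefree_poly (\prod_i p i).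
Proof.
have p0 i : p i != 0 := irredp_neq0 (p_irr i).
have prod_neq0 : \prod_i p i != 0 by apply/prodf_neq0 => i _.
move=> d d2; have d0 : d != 0.
  by apply: contraNneq prod_neq0 => d0; move: d2; rewrite d0 expr0n /= dvd0p.
have [d1 | /irredp_factor[q q_irr q_d]] := leqP (size d) 1.
  by rewrite -size_poly_eq1 eqn_leq d1 size_poly_gt0.
have q2 : q ^+ 2 %| \prod_i p i by apply: dvdp_trans d2; apply: dvdp_exp2r.
have prod_expand : \prod_i p i = \prod_i p i ^+ 1 by apply: eq_bigr => i _.
have : q %| \prod_i p i by apply: dvdp_trans q2; apply: dvdp_mulr.
have q_size : size q != 1%N by case: (q_irr); case: (size q) => [|[|]].
rewrite prod_expand irredp_dvd_prodX // => /existsP[j q_pj].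
have qE : q %= p j by case: (p_irr j) => _; apply.
have : q %| \prod_(i | i != j) p i.
  have prodE : \prod_i p i = p j * \prod_(i | i != j) p i by rewrite (bigD1 j).
  rewrite -(@dvdp_mul2l _ (p j)) ?p0 // -prodE.
  by apply: dvdp_trans q2; rewrite expr2 dvdp_mul // -(eqp_dvdl _ qE).
elim/big_ind: _ => [|f g IHf IHg|i ij q_pi].
- by rewrite dvdp1 (negPf q_size).
- by rewrite irredp_dvdM // => /orP[].
have : q %= p i by case: (p_irr i) => _; apply.
by move=> qEi; have := p_distinct ij; rewrite -(eqp_ltrans qEi) qE.
Qed.

End IrreducibleProducts.

(** * Exponent arithmetic for [P_1], [P_2], [A], [B] and [D] *)

Section BasisFactors.
Variables (F : fieldType) (s : nat) (p : 'I_s -> {poly F}) (l : 'I_s -> nat).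
Hypothesis l_coprime3 : forall i, coprime (l i) 3.

Lemma prodX_mul (e f : 'I_s -> nat) :
  (\prod_i p i ^+ e i) * (\prod_i p i ^+ f i) = \prod_i p i ^+ (e i + f i)%N.
Proof. by rewrite -big_split; apply: eq_bigr => i _; rewrite exprD. Qed.

(** Gives [A] for [r = 2] and [B] for [r = 1]; the Boolean is read as an exponent 0 or 1. *)
Definition mod3_factor (r : nat) := \prod_i p i ^+ (l i %% 3 == r)%N.

(* Named after the trace of w, which is -2 D. *)
Definition trace_factor := \prod_i p i ^+ (1 + (2 * 2 * l i) %/ 3 - l i)%N.

Lemma coprime3_mod n : coprime n 3 -> (n %% 3 = 1 \/ n %% 3 = 2)%N.
Proof.
rewrite coprime_sym prime_coprime // /dvdn => n3.
have := ltn_pmod n (isT : 0 < 3)%N; lia.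
Qed.

(** For [l i = 3 k + r] with [r] equal to 1 or 2, the exponents in [P_1] and [P_2] are [2 k + r] and
    [4 k + r + 1]. This identity and the next two compare such exponents. *)
Lemma basis_factor1_sqr :
  basis_factor p l 1 ^+ 2 = mod3_factor 2 * basis_factor p l 2.
Proof.
rewrite expr2 !prodX_mul; apply: eq_bigr => i _; congr (_ ^+ _).
have := coprime3_mod (l_coprime3 i); lia.
Qed.

Lemma basis_factor2_sqr :
  basis_factor p l 2 ^+ 2
  = mod3_factor 1 * (\prod_i p i ^+ l i) ^+ 2 * basis_factor p l 1.
Proof.
rewrite !expr2 !prodX_mul; apply: eq_bigr => i _; congr (_ ^+ _).
have := coprime3_mod (l_coprime3 i); lia.
Qed.

Lemma basis_factor12 :
  basis_factor p l 1 * basis_factor p l 2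
  = mod3_factor 2 * mod3_factor 1 * (\prod_i p i ^+ l i) ^+ 2.
Proof.
rewrite !expr2 !prodX_mul; apply: eq_bigr => i _; congr (_ ^+ _).
have := coprime3_mod (l_coprime3 i); lia.
Qed.

Lemma basis_factor2_trace :
  basis_factor p l 2 = trace_factor * \prod_i p i ^+ l i.
Proof.
(* The truncated subtraction is exact, because the integral part of [4 l / 3] is at least [l]. *)
rewrite prodX_mul; apply: eq_bigr => i _; congr (_ ^+ _); lia.
Qed.

Lemma mod3_factorM : mod3_factor 2 * mod3_factor 1 = \prod_i p i.
Proof.
rewrite prodX_mul; apply: eq_bigr => i _; rewrite -[RHS]expr1; congr (_ ^+ _).
have := coprime3_mod (l_coprime3 i); lia.
Qed.

End BasisFactors.

(** * Coordinates from the powers of the generator *)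

Lemma horner_map_Poly3 (R S : comNzRingType) (h : {rmorphism R -> S}) r0 r1 r2 z :
  (map_poly h (Poly [:: r0; r1; r2])).[z] = h r0 + h r1 * z + h r2 * z ^+ 2.
Proof.
rewrite (@horner_coef_wide _ 3).
  by rewrite !big_ord_recl big_ord0 !coef_map !coef_Poly /=; ring.
exact: leq_trans (size_poly _ _) (size_Poly _).
Qed.

Lemma cubic_elt_horner (F : finFieldType) (L : fieldType)
    (h : {rmorphism {fraction {poly F}} -> L}) (r1 r2 : {fraction {poly F}}) (z : L) x :
  cubic_elt h (h r1 * z) (h r2 * z ^+ 2) x =
  (map_poly h (Poly [:: x.1.1; x.1.2 * r1; x.2 * r2])).[z].
Proof. by rewrite horner_map_Poly3 /cubic_elt 2![h (_ * _)]rmorphM !mulrA. Qed.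

Section CubicGenerator.
Variables (F : finFieldType) (L : fieldExtType {fraction {poly F}}) (z : L).
Local Notation K := {fraction {poly F}}.
Hypotheses (z_generator : <<1%AS; z>>%VS = {:L}%VS)
  (z_degree : adjoin_degree 1%AS z = 3%N).

(** Each element of [L] is a unique polynomial in [z] of degree at most 2; rescaling coefficients by
    nonzero [r1] and [r2] preserves this. *)
Lemma cubic_generator_bijective (r1 r2 : K) : r1 != 0 -> r2 != 0 ->
  bijective (cubic_elt (in_alg L) (in_alg L r1 * z) (in_alg L r2 * z ^+ 2)).
Proof.
move=> r1_neq0 r2_neq0; apply: inj_surj_bijective => [x y|y].
  rewrite !cubic_elt_horner => xy.
  have uniq_poly t : Fadjoin_poly 1%AS z (map_poly (in_alg L) (Poly t)).[z]
      = map_poly (in_alg L) (Poly t) \/ (3 < size t)%N.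
    have [t3|t3] := leqP (size t) 3; last by right.
    left; apply: Fadjoin_poly_unique => //; first by apply/polyOver1P; exists (Poly t).
    by rewrite z_degree size_map_poly (leq_trans (size_Poly t)).
  have [Ex|//] := uniq_poly [:: x.1.1; x.1.2 * r1; x.2 * r2].
  have [Ey|//] := uniq_poly [:: y.1.1; y.1.2 * r1; y.2 * r2].
  have {xy} /map_poly_inj/polyP Exy :
      map_poly (in_alg L) (Poly [:: x.1.1; x.1.2 * r1; x.2 * r2])
      = map_poly (in_alg L) (Poly [:: y.1.1; y.1.2 * r1; y.2 * r2]).
    by rewrite -Ex -Ey xy.
  have := (Exy 0%N, Exy 1%N, Exy 2%N); rewrite !coef_Poly /=.
  case=> [[E0 /(mulIf r1_neq0) E1] /(mulIf r2_neq0) E2].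
  by rewrite (surjective_pairing x) (surjective_pairing x.1) E0 E1 E2 -!surjective_pairing.
have y_z : y \in <<1%AS; z>>%VS by rewrite z_generator memvf.
have [r Er] := polyOver1P (Fadjoin_polyOver 1%AS z y).
exists (r`_0, r`_1 / r1, r`_2 / r2).
have size_r : (size r <= 3)%N.
  by rewrite -z_degree -(size_map_poly (in_alg L)) -Er; apply: size_Fadjoin_poly.
rewrite cubic_elt_horner -[RHS](Fadjoin_poly_eq y_z) Er; congr (map_poly _ _).[z].
rewrite /fst /snd (divfK r1_neq0) (divfK r2_neq0).
apply/polyP => i; rewrite coef_Poly.
by case: i => [|[|[|i]]] //=; rewrite !nth_default // (leq_trans size_r).
Qed.

End CubicGenerator.

(** * The minimal polynomial of [z] and the integral basis *)

Lemma size_depressed_cubic (R : nzRingType) (b d : R) :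
  size ('X^3 + b *: 'X + d%:P) = 4%N.
Proof.
rewrite -addrA size_polyDl size_polyXn // ltnS.
rewrite (leq_trans (size_polyD _ _)) // geq_max (leq_trans (size_scale_leq _ _)) ?size_polyX //.
by rewrite (leq_trans (size_polyC_leq1 _)).
Qed.

Lemma horner_map_depressed_cubic (R S : comNzRingType) (h : {rmorphism R -> S}) b d z :
  (map_poly h ('X^3 + b *: 'X + d%:P)).[z] = z ^+ 3 + h b * z + h d.
Proof.
by rewrite !rmorphD /= map_polyXn map_polyZ map_polyX map_polyC !hornerE.
Qed.

(** Allows [poly_emb] to play the role of [emb] in the results on the cubic order. *)
HB.instance Definition _ (F : fieldType) (L : fieldExtType {fraction {poly F}}) :=
  GRing.RMorphism.copy (@poly_emb F L) (in_alg L \o @FracField.tofrac {poly F}).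

Theorem theorem3p1
  (n : nat) (F : finFieldType) (cardF : #|F| = (3 ^ n)%N)
  (L : fieldExtType {fraction {poly F}})
  (L_cubic : \dim {:L} = 3%N)
  (L_separable : separable 1%AS {:L})
  (z : L) (z_generator : <<1%AS; z>>%VS = {:L}%VS)
  (b : {fraction {poly F}})
  (z_minPoly : minPoly 1%AS z =
     map_poly (in_alg L) ('X^3 + b *: 'X + (b ^+ 2)%:P))
  (b_places : forall q : {poly F}, finite_place q ->
     0 <= place_val q b \/ (place_val q b < 0 /\ coprimez (place_val q b) 3))
  (xi1 xi2 beta : {poly F}) (s : nat)
  (p : 'I_s -> {poly F}) (l : 'I_s -> nat)
  (b_eq : b = tofrac (xi1 * xi2 ^+ 2) / tofrac beta)
  (beta_eq : beta = \prod_(i < s) p i ^+ l i)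
  (xi1_squarefree : squarefree_poly xi1)
  (xi_beta_coprime : coprimep (xi1 * xi2) beta)
  (p_irreducible : forall i, irreducible_poly (p i))
  (p_distinct : forall i j, i != j -> ~~ (p i %= p j))
  (l_gt0 : forall i, (0 < l i)%N)
  (l_coprime3 : forall i, coprime (l i) 3) :
  integral_basis
    [tuple poly_emb L (basis_factor p l 2) / poly_emb L (xi1 * xi2 ^+ 2) * z ^+ 2;
           poly_emb L (basis_factor p l 1) / poly_emb L xi2 * z;
           1].
Proof.
have F_char3 : 3%:R = 0 :> F.
  by have /andP[_ /eqP] := card_finPcharP cardF (isT : prime 3).
have z_degree : adjoin_degree 1%AS z = 3%N.
  by apply: succn_inj; rewrite -size_minPoly z_minPoly size_map_poly size_depressed_cubic.
have z_root : z ^+ 3 + in_alg L b * z + in_alg L b ^+ 2 = 0.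
  rewrite -rmorphXn -horner_map_depressed_cubic -z_minPoly; apply/rootP.
  exact: root_minPoly.
have p0 i : p i != 0 := irredp_neq0 (p_irreducible i).
have prod0 (e : 'I_s -> nat) : \prod_i p i ^+ e i != 0.
  by apply/prodf_neq0 => i _; rewrite expf_neq0.
have beta0 : beta != 0 by rewrite beta_eq.
(* Zero is not square-free, being divisible by the square of ['X]. *)
have xi1_0 : xi1 != 0.
  apply/eqP => xi10; have := xi1_squarefree 'X; rewrite xi10 dvdp0.
  by move=> /(_ isT)/eqp_size; rewrite size_polyX size_poly1.
(* Otherwise [b = 0], hence [z = 0], which has degree 1 instead of 3. *)
have xi2_0 : xi2 != 0.
  apply: contra_eq_neq z_degree => xi20; have z0 : z = 0.
    have z3 : z ^+ 3 = 0.
      move: z_root; rewrite b_eq xi20 expr0n mulr0 !rmorph0 mul0r rmorph0 mul0r.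
      by rewrite expr0n !addr0.
    by move/eqP: z3; rewrite expf_eq0 => /eqP.
  have /minPoly_XsubC z_min : z \in 1%AS by rewrite z0 mem0v.
  by rewrite -eqSS -size_minPoly z_min size_XsubC.
pose emb := poly_emb L.
have embE f : poly_emb L f = in_alg L (tofrac f) by [].
have emb0 f : f != 0 -> emb f != 0.
  by move=> f0; rewrite /emb embE fmorph_eq0 tofrac_eq0.
have embM f g : emb (f * g) = emb f * emb g by apply: rmorphM.
have embX f k : emb (f ^+ k) = emb f ^+ k by apply: rmorphXn.
pose A := mod3_factor p l 2; pose B := mod3_factor p l 1.
pose D := trace_factor p l.
pose u := poly_emb L (basis_factor p l 1) / poly_emb L xi2 * z.
pose w := poly_emb L (basis_factor p l 2) / poly_emb L (xi1 * xi2 ^+ 2) * z ^+ 2.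
have [uu uw ww] : [/\ u ^+ 2 = emb (A * xi1) * w,
    u * w = - (emb D * u + emb (A * B * xi1 * xi2))
  & w ^+ 2 = - (emb D * w + emb (B * xi2) * u)].
  rewrite /w /u -/emb (embM xi1) (embX xi2) (embM (A * B * xi1)).
  rewrite (embM (A * B)) !(embM A) !(embM B).
  apply: (@cubic_order_relations _ z _ _ (emb beta)); rewrite ?emb0 //.
  - have bE : in_alg L b = emb xi1 * emb xi2 ^+ 2 / emb beta.
      rewrite -(embX xi2 2) -(embM xi1 (xi2 ^+ 2)) /emb !embE b_eq.
      by rewrite fmorph_div.
    by rewrite -bE.
  - by rewrite -embX basis_factor1_sqr // embM.
  - by rewrite -embX basis_factor2_sqr // -beta_eq -embX -!embM.
  - by rewrite -embM basis_factor12 // -beta_eq -embX -!embM.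
  - by rewrite basis_factor2_trace embM beta_eq.
have uw_bij : bijective (cubic_elt (in_alg L) u w).
  have r0 f g : f != 0 -> g != 0 -> tofrac f / tofrac g != 0 :> {fraction {poly F}}.
    by move=> f0 g0; rewrite mulf_neq0 ?invr_eq0 ?tofrac_eq0.
  have embV f g : in_alg L (tofrac f / tofrac g) = emb f / emb g.
    by rewrite /emb !embE fmorph_div.
  rewrite /u /w -/emb -!embV.
  apply: cubic_generator_bijective => //.
    by apply: r0; first exact: prod0.
  by apply: r0; [exact: prod0 | rewrite mulf_neq0 ?expf_neq0].
have AB : A * B = \prod_i p i by apply: mod3_factorM.
have AB_sqf : squarefree_poly (A * B) by rewrite AB; apply: squarefree_prod.
have prod1 : \prod_i p i = \prod_i p i ^+ 1 by apply: eq_bigr => i _.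
have dvd_D q : irreducible_poly q -> (q %| D) = (q %| A * B).
  (* All exponents in [trace_factor] are positive, so [D] involves every [p i]. *)
  move=> q_irr; rewrite AB prod1 !irredp_dvd_prodX // => i.
  by have := coprime3_mod (l_coprime3 i); have := l_gt0 i; lia.
have coprime_D : coprimep (xi1 * xi2) D.
  rewrite /D /trace_factor; elim/big_ind: _ => [|f g cf cg|i _].
  - exact: coprimep1.
  - by rewrite coprimepMr cf.
  apply: coprimep_expr; apply: coprimep_dvdl xi_beta_coprime.
  by rewrite beta_eq (bigD1 i) //= dvdp_mulr // dvdp_exp.
pose i1 : 'I_3 := lift ord0 ord0; pose i2 : 'I_3 := lift ord0 (lift ord0 ord0).
(* The tuple lists [w, u, 1], the reverse of the order of coordinates in [cubic_elt]. *)
have combE (f : 'I_3 -> {poly F}) : \sum_(i < 3) emb (f i) * tnth [tuple w; u; 1] i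
    = cubic_elt (in_alg L) u w (cubic_polys (f i2, f i1, f ord0)).
  transitivity (emb (f i2) + emb (f i1) * u + emb (f ord0) * w); last by [].
  by rewrite !big_ord_recl big_ord0 addr0 !(tnth_nth 0) mulr1 addrC [X in X + _]addrC.
split=> [y|f].
- rewrite -/u -/w; split=> [Iy | [f ->]].
    have [d ->] := integral_in_cubic_order embE uu uw ww uw_bij F_char3 AB_sqf
      xi1_squarefree dvd_D coprime_D Iy.
    exists (fun i => nth 0 [:: d.2; d.1.2; d.1.1] i); rewrite combE.
    by case: d => [[]].
  rewrite combE; apply: (in_cubic_order_integral embE uu uw ww).
  by eexists.
rewrite -/u -/w combE => f0.
have [g eltK _] := uw_bij.
have : cubic_polys (f i2, f i1, f ord0) = cubic_polys (0, 0, 0).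
  apply: (can_inj eltK); rewrite f0.
  transitivity (emb 0 + emb 0 * u + emb 0 * w); last by [].
  by rewrite /emb !rmorph0 !mul0r !addr0.
case=> /eqP; rewrite tofrac_eq => /eqP f2 /eqP; rewrite tofrac_eq => /eqP f1 /eqP.
rewrite tofrac_eq => /eqP f0' [[|[|[|//]]] lt_i].
- by rewrite -f0'; congr f; apply: val_inj.
- by rewrite -f1; congr f; apply: val_inj.
- by rewrite -f2; congr f; apply: val_inj.
Qed.
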